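(* Consider the $(\mathsf H,r,M,N)$ combination network with end-user-caches, with $K=\binom{\mathsf H}{r}$ users. For each $x\in\{r,r+1,\dots,\mathsf H\}$, the optimal max-link load under uncoded cache placement $R^\star_{\mathrm u}(M)$, as a function of $M\in[0,N]$, is lower bounded by the lower convex envelope of the points $$\left(t\,\frac{N}{\binom xr},\ \frac1x\cdot\frac{\binom{\binom xr}{t+1}-\binom{\max\left\{\binom xr-N,\,0\right\}}{t+1}}{\binom{\binom xr}{t}}\right),\qquad t\in\left\{0,1,\dots,\tbinom xr\right\}.$$
   Context: Notation: $[n]=\{1,\dots,n\}$; $\binom ab=0$ if $a<b$. Network. An $(\mathsf H,r,M,N)$ combination network with end-user-caches ($1\le r\le\mathsf H$, $0\le M\le N$) has one server with $N$ files $F_1,\dots,F_N$, each consisting of $B$ independent uniform bits (files mutually independent), $\mathsf H$ relays without caches, and $K=\binom{\mathsf H}{r}$ users, each connected to a distinct $r$-subset of the relays. The server is connected to every relay. All links are error-free and interference-free. $\mathcal U_h\subseteq[K]$ is the set of users connected to relay $h$ and $\mathcal H_k\subseteq[\mathsf H]$ the set of relays connected to user $k$. Scheme. In the placement phase user $k$ stores a content $Z_k$ of at most $MB$ bits (a function of the files) without knowing the demands. The placement is uncoded if each $Z_k$ consists of bits copied directly from the files. In the delivery phase user $k$ demands $F_{d_k}$, $d_k\in[N]$; the demand vector $\mathbf d=(d_1,\dots,d_K)$ is known to all nodes. The server sends to relay $h$ a message $X_h$ of $B R_h(\mathbf d)$ bits, and relay $h$ sends to each user $k\in\mathcal U_h$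 a message $X_{h\to k}$ (a function of $X_h$) of $B R_{h\to k}(\mathbf d)$ bits. User $k$ must recover $F_{d_k}$ from $Z_k$ and $(X_{h\to k}:h\in\mathcal H_k)$ with high probability. The max-link load of a scheme is $\max_{h,\,k\in\mathcal U_h,\,\mathbf d\in[N]^K}\max\{R_h(\mathbf d),R_{h\to k}(\mathbf d)\}$. A load $R$ is achievable for memory $M$ if there is a sequence of schemes with file sizes $B\to\infty$, error probability tending to $0$ and max-link load with limsup at most $R$. $R^\star_{\mathrm u}(M)$ is the minimum load achievable with uncoded placement. *)

(* Defs.v *)
From HB Require Import structures.
From mathcomp Require Import all_boot all_order all_algebra.
From mathcomp Require Import all_classical all_reals all_analysis.
Set Implicit Arguments.
Unset Strict Implicit.
Unset Printing Implicit Defensive.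
Import Order.TTheory GRing.Theory Num.Theory.
Import numFieldNormedType.Exports.
Local Open Scope classical_set_scope.
Local Open Scope ring_scope.

(* A user is identified with the r-subset of relays it is connected to. *)
Definition user (H r : nat) : finType := {A : {set 'I_H} | #|A| == r}.

Definition relays (H r : nat) (k : user H r) : {set 'I_H} := sval k.

Lemma card_user (H r : nat) : #|user H r| = 'C(H, r).
Proof.
rewrite card_sig -[in RHS](card_ord H) -card_draws.
by apply: eq_card => A; rewrite !inE.
Qed.

Definition files (N B : nat) : finType := {ffun 'I_N -> B.-tuple bool}.

Definition demand (H r N : nat) : finType := {ffun user H r -> 'I_N}.

(* All lengths are numbers of bits.  For uniformity [link_msg] is indexed by
   all pairs (h, k); only the pairs with [h \in relays k] are links, and no
   other pair is seen by a decoder or counted in the load. *)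
Record scheme (H r N B : nat) := Scheme {
  cache_len : user H r -> nat;
  cache : forall k, files N B -> (cache_len k).-tuple bool;
  relay_len : demand H r N -> 'I_H -> nat;
  relay_msg : forall d h, files N B -> (relay_len d h).-tuple bool;
  link_len : demand H r N -> 'I_H -> user H r -> nat;
  link_msg : forall d h k,
    (relay_len d h).-tuple bool -> (link_len d h k).-tuple bool;
  decoder : forall d k, (cache_len k).-tuple bool ->
    (forall h : {h : 'I_H | h \in relays k},
       (link_len d (sval h) k).-tuple bool) ->
    B.-tuple bool
}.

Section Scheme.
Variables (R : realType) (H r N B : nat) (S : scheme H r N B).

Definition uncoded : Prop :=
  forall k, exists pos : (cache_len S k).-tuple ('I_N * 'I_B),
  forall F : files N B,
    cache S k F = [tuple of [seq tnth (F p.1) p.2 | p <- pos]].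

Definition cache_within (M : R) : Prop :=
  forall k, (cache_len S k)%:R <= M * B%:R.

Definition decoded (d : demand H r N) (F : files N B) (k : user H r) :
    B.-tuple bool :=
  decoder (cache S k F)
    (fun h : {h : 'I_H | h \in relays k} =>
       link_msg k (relay_msg S d (sval h) F)).

(* The files are uniform on [files N B], i.e. all N * B bits are i.i.d.
   uniform; the maximum is over the demands. *)
Definition error_prob : R :=
  \big[Num.max/0]_(d : demand H r N)
    (#|[pred F : files N B | [exists k, decoded d F k != F (d k)]]|%:R
     / #|files N B|%:R).

Definition relay_load (d : demand H r N) (h : 'I_H) : R :=
  (relay_len S d h)%:R / B%:R.

Definition link_load (d : demand H r N) (h : 'I_H) (k : user H r) : R :=
  (link_len S d h k)%:R / B%:R.

Definition max_link_load : R :=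
  \big[Num.max/0]_(h : 'I_H) \big[Num.max/0]_(k : user H r | h \in relays k)
    \big[Num.max/0]_(d : demand H r N)
      Num.max (relay_load d h) (link_load d h k).

End Scheme.

Definition achievable_uncoded (R : realType) (H r N : nat) (M L : R) : Prop :=
  exists (B : nat -> nat) (S : forall n, scheme H r N (B n)),
  [/\ B n @[n --> \oo] --> \oo,
      forall n, uncoded (S n) /\ cache_within (S n) M,
      error_prob R (S n) @[n --> \oo] --> (0 : R) &
      (limn_esup (fun n => (max_link_load R (S n))%:E) <= L%:E)%E].

Definition opt_uncoded_load (R : realType) (H r N : nat) (M : R) : \bar R :=
  ereal_inf [set L%:E | L in [set L : R | achievable_uncoded H r N M L]].

(* The lower boundary, at abscissa [x], of the convex hull of the points
   [p i]; it is +oo when no point of the hull has abscissa [x]. *)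
Definition lower_convex_envelope (R : realType) (n : nat)
    (p : 'I_n -> R * R) (x : R) : \bar R :=
  ereal_inf [set y%:E | y in
    [set y : R | exists w : 'I_n -> R,
      [/\ forall i, 0 <= w i,
          \sum_(i < n) w i = 1,
          \sum_(i < n) w i * (p i).1 = x &
          \sum_(i < n) w i * (p i).2 = y]]].

(* Main.v *)
(* Keep only the users served by the relays [h < x] alone: the messages of these
   x relays serve them all, so x times the load bounds a shared-link load with
   ['C(x, r)] users.  Order some of them so that their demands are distinct.
   Decoding along the order recovers every bit of the i-th demanded file that
   none of the first i users caches, so such "unknown" bits cannot outnumber
   the bits sent by the relays; since all file contents are equally likely and
   the cached bits are plain file bits, this is a count of file contents and no
   entropy is needed (an error probability of at most 1/2 costs one bit).
   Averaging over all orders of the users and all cyclic shifts of the files, a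
   bit cached by exactly t users contributes a quantity depending only on t,
   and the hockey-stick identity turns it into the ordinate of the t-th point.
   The fractions of bits cached by t users are then the weights of a convex
   combination; its abscissa is at most M, and mixing in the last point (N, 0)
   raises it to M without raising the ordinate. *)
Require Import Defs.
From HB Require Import structures.
From mathcomp Require Import all_boot all_order all_algebra all_fingroup.
From mathcomp Require Import all_classical all_reals all_analysis.
From mathcomp Require Import zify lra ring.
Set Implicit Arguments.
Unset Strict Implicit.
Unset Printing Implicit Defensive.
Import Order.TTheory GRing.Theory Num.Theory.
Local Open Scope ring_scope.

(** * File contents as families of bits *)

Section Bits.
Variables N B : nat.
Implicit Types (F : files N B) (p : 'I_N * 'I_B).

Definition bit F p : bool := tnth (F p.1) p.2.

Lemma bit_inj F F' : bit F =1 bit F' -> F = F'.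
Proof.
move=> eqF; apply/ffunP => n; apply: eq_from_tnth => b.
exact: (eqF (n, b)).
Qed.

Lemma card_files : #|files N B| = (2 ^ (N * B))%N.
Proof. by rewrite card_ffun card_tuple card_bool card_ord -expnM mulnC. Qed.

End Bits.

(** * Counting bound on the unknown bits for one demand vector *)

Section Converse.
Variables (H r N B : nat) (S : scheme H r N B).

(** What uncoded placement gives to the counting. The size is bounded by an inequality because a
    cache may hold several copies of the same bit. *)
Definition cached_bits (k : user H r) (C : {set 'I_N * 'I_B}) : Prop :=
  (#|C| <= cache_len S k)%N /\
  forall F F' : files N B,
    {in C, bit F =1 bit F'} -> cache S k F = cache S k F'.

Lemma uncoded_cached_bits :
  uncoded S -> exists C : user H r -> {set 'I_N * 'I_B},
    forall k, cached_bits k (C k).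
Proof.
move=> uS; suff /choice[C HC] : forall k, exists C, cached_bits k C by exists C.
move=> k; have [pos posE] := uS k; exists [set p in tval pos]; split.
  by rewrite -[leqRHS](size_tuple pos) cardsE card_size.
move=> F F' eqF; rewrite !posE; apply: val_inj => /=; apply/eq_in_map => p pin.
by apply: eqF; rewrite inE.
Qed.

Lemma half_decoded (R : realType) (d : demand H r N) :
  error_prob R S <= 2^-1 ->
  (#|files N B| <= 2 * #|[pred F | [forall k, decoded S d F k == F (d k)]]|)%N.
Proof.
set G := [pred F | _] => err.
pose D := [pred F : files N B | [exists k, decoded S d F k != F (d k)]].
have cGD : (#|G| + #|D| = #|files N B|)%N.
  by rewrite -(cardC G); congr addn.
have f0 : (0 < #|files N B|%:R :> R).
  by rewrite ltr0n card_files expn_gt0.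
have : #|D|%:R / #|files N B|%:R <= 2^-1 :> R.
  by apply: le_trans err; rewrite /error_prob (bigmaxD1 d)// le_max lexx.
rewrite ler_pdivrMr// mulrC ler_pdivlMr// -natrM ler_nat -cGD.
lia.
Qed.

Variables (d : demand H r N) (C : user H r -> {set 'I_N * 'I_B}).
Hypothesis HC : forall k, cached_bits k (C k).
Variables (m : nat) (v : 'I_m -> user H r) (T : {set 'I_H}).
Hypothesis vT : forall i, relays (v i) \subset T.

Definition unknown_bits : {set 'I_N * 'I_B} :=
  [set p | [exists i : 'I_m, (p.1 == d (v i)) &&
     [forall j : 'I_m, (j <= i)%N ==> (p \notin C (v j))]]].

(** Induction along the order: an unknown bit cached by [v i] belongs to the file demanded by some
    earlier [v j], which is already recovered. So [v i] has the same cache and receives the same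
    messages under [F] and [F'], and decodes the same file. *)
Lemma relays_determine_files (F F' : files N B) :
  (forall k, decoded S d F k = F (d k)) ->
  (forall k, decoded S d F' k = F' (d k)) ->
  {in T, forall h, relay_msg S d h F = relay_msg S d h F'} ->
  {in ~: unknown_bits, bit F =1 bit F'} -> F = F'.
Proof.
move=> dF dF' eqm eqb.
have eqd (i : 'I_m) : F (d (v i)) = F' (d (v i)).
  have [n] := ubnP (i : nat); elim: n i => // n IH i; rewrite ltnS => lein.
  have eqc : cache S (v i) F = cache S (v i) F'.
    apply: (HC (v i)).2 => p pC.
    have [|pu] := boolP (p \in unknown_bits); last by apply: eqb; rewrite inE.
    rewrite inE => /existsP[j /andP[/eqP pj /forallP/(_ i)]].
    case: leqP; first by rewrite pC.
    by move=> ji _; rewrite /bit pj (IH j)// (leq_trans ji).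
  rewrite -dF -dF' /decoded eqc; congr (decoder _ _).
  apply: functional_extensionality_dep => -[h hk] /=.
  by rewrite eqm//; exact: (fintype.subsetP (vT i)).
apply: bit_inj => p.
have [|pu] := boolP (p \in unknown_bits); last by apply: eqb; rewrite inE.
by rewrite inE => /existsP[j /andP[/eqP pj _]]; rewrite /bit pj eqd.
Qed.

(** The relay bits and the bits outside [unknown_bits] together determine a correctly decoded
    content. Such contents are at least half of all contents, and this factor 2 is the [.+1]. *)
Lemma card_unknown_bits (R : realType) :
  error_prob R S <= 2^-1 ->
  (#|unknown_bits| <= (\sum_(h in T) relay_len S d h).+1)%N.
Proof.
move=> /(half_decoded d); set G := [pred F | _].
pose msgbit := {h : 'I_H & 'I_(relay_len S d h)}.
pose Q := [set q : msgbit | tag q \in T].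
(* Bit strings are coded as the sets of positions of their ones, so that codes are counted by
   powersets. *)
pose enc (F : files N B) : {set msgbit} * {set 'I_N * 'I_B} :=
  ([set q in Q | tnth (relay_msg S d (tag q) F) (tagged q)],
   [set p in ~: unknown_bits | bit F p]).
have enc_inj : {in G &, injective enc}.
  move=> F F' /forallP dF /forallP dF' [/setP eq1 /setP eq2].
  apply: relays_determine_files.
  - by move=> k; apply/eqP.
  - by move=> k; apply/eqP.
  - move=> h hT; apply: eq_from_tnth => i.
    by have := eq1 (Tagged (fun h => 'I_(relay_len S d h)) i);
      rewrite !inE /= hT.
  - move=> p; have := eq2 p; move: (~: _) => K; rewrite !inE => + pK.
    by rewrite (pK : (p : 'I_N * 'I_B) \in K).
have cG : (#|G| <= 2 ^ (#|Q| + #|~: unknown_bits|))%N.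
  rewrite -(card_in_image enc_inj) expnD -!card_powerset -cardsX.
  apply: subset_leq_card; apply/fintype.subsetP => _ /fintype.imageP[F _ ->].
  rewrite !inE /=; apply/andP; split; apply/fintype.subsetP => q; rewrite !inE.
    by case/andP.
  by case/andP.
have cQ : #|Q| = (\sum_(h in T) relay_len S d h)%N.
  under [RHS]eq_bigr do rewrite -(card_ord (relay_len _ _ _)) -sum1_card.
  rewrite -sum1_card.
  by rewrite sig_big_dep /=; apply: eq_bigl => q; rewrite !inE andbT.
have cU : (#|unknown_bits| + #|~: unknown_bits| = N * B)%N.
  by rewrite cardsC card_prod !card_ord.
rewrite card_files -cU -cQ => le1.
have := leq_trans le1 (leq_mul (leqnn 2) cG); rewrite -expnS leq_exp2l//.
lia.
Qed.

End Converse.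

(** * Permutations avoiding a set, and the hockey-stick identity *)

(** List [C] and then its complement, and likewise for [D]; the permutation matches the two lists
    position by position. *)
Lemma perm_imset_eq_card (T : finType) (C D : {set T}) :
  #|C| = #|D| -> exists u : {perm T}, u @: C = D.
Proof.
move=> cCD; pose e (A : {set T}) := enum A ++ enum (~: A).
have e_mem A y : y \in e A by rewrite mem_cat !mem_enum inE orbN.
have e_uniq A : uniq (e A).
  rewrite cat_uniq !enum_uniq andbT /=; apply/hasPn => y.
  by rewrite !mem_enum inE.
have e_size A : size (e A) = #|T| by rewrite size_cat -!cardE cardsC.
pose f y := nth y (e D) (index y (e C)).
have lt_index y : (index y (e C) < size (e D))%N.
  by rewrite e_size -(e_size C) index_mem.
have f_inj : injective f.
  move=> y z; rewrite /f (set_nth_default z)// => /eqP.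
  rewrite nth_uniq// => /eqP eqi.
  by rewrite -(nth_index z (e_mem C y)) eqi nth_index.
exists (perm f_inj); apply/eqP; rewrite eqEcard.
rewrite card_imset; last exact: perm_inj.
rewrite cCD leqnn andbT; apply/fintype.subsetP => _ /imsetP[y yC ->].
have yi : (index y (e C) < #|D|)%N.
  by rewrite index_cat mem_enum yC -cCD cardE index_mem mem_enum.
by rewrite permE /f nth_cat -cardE yi -mem_enum mem_nth// -cardE.
Qed.

Lemma card_perms (T : finType) : #|{perm T}| = (#|T|)`!.
Proof.
rewrite -[in RHS]cardsT -card_perm; apply: eq_card => s.
by rewrite [RHS]unfold_in; apply/esym/fintype.subsetP => y; rewrite inE.
Qed.

Lemma card_ord_lt (n k : nat) : (k <= n)%N -> #|[set j : 'I_n | (j < k)%N]| = k.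
Proof.
by move=> kn; rewrite cardsE -sum1_card (big_ord_narrow kn) sum1_card card_ord.
Qed.

Definition avoiding_perms (T : finType) (J C : {set T}) : {set {perm T}} :=
  [set s : {perm T} | [disjoint s @: J & C]].

(** If [u] maps [C] onto [D], then right multiplication by [u] is a bijection between the two
    sets. *)
Lemma card_avoiding_perms_eq (T : finType) (J C D : {set T}) :
  #|C| = #|D| -> #|avoiding_perms J C| = #|avoiding_perms J D|.
Proof.
move=> /perm_imset_eq_card[u <-].
rewrite -(card_imset _ (mulIg u)); apply: eq_card => s.
apply/imsetP/idP => [[w wJC ->]|]; rewrite ?inE.
  move: wJC; rewrite inE => /disjoint_setI0 wJC; rewrite -setI_eq0.
  have -> : (w * u)%g @: J = u @: (w @: J).
    by rewrite -imset_comp; apply: eq_imset => y; rewrite permM.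
  by rewrite -imsetI ?wJC ?imset0//; apply: in2W; exact: perm_inj.
move=> /disjoint_setI0 suJ; exists (s * u^-1)%g; last by rewrite mulgKV.
rewrite inE -setI_eq0; apply/eqP/setP => y; rewrite !inE; apply/negP.
case/andP => /imsetP[j jJ ->]; rewrite permM => uC.
have : s j \in s @: J :&: u @: C.
  by rewrite inE imset_f//= -(permKV u (s j)) imset_f.
by rewrite suJ inE.
Qed.

(* Double counting of the pairs (s, D) with [#|D| = #|C|] and [D] disjoint from
   [s @: J]; by symmetry every [D] lies in equally many pairs. *)
Lemma card_avoiding_perms (T : finType) (J C : {set T}) :
  ('C(#|T|, #|C|) * #|avoiding_perms J C| = (#|T|)`! * 'C(#|T| - #|J|, #|C|))%N.
Proof.
transitivity (\sum_(D : {set T} | #|D| == #|C|) #|avoiding_perms J D|)%N.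
  under eq_bigr => D /eqP cD do rewrite (card_avoiding_perms_eq J cD).
  rewrite sum_nat_const -card_draws; congr (_ * _)%N.
  by apply: eq_card => D; rewrite inE.
under eq_bigr do rewrite -sum1_card.
rewrite -card_perms (exchange_big_dep predT)//= -sum_nat_const.
apply: eq_bigr => s _.
rewrite sum1dep_card.
have <- : #|~: (s @: J)| = (#|T| - #|J|)%N.
  by rewrite cardsCs finset.setCK (card_imset _ (@perm_inj _ s)).
rewrite -cards_draws; apply: eq_card => D.
by rewrite !inE disjoint_sym finset.disjoints_subset andbC.
Qed.

(** Hockey-stick identity with only its [m] largest terms summed; the second binomial collects the
    rest. *)
Lemma sum_bin_sub (n m t : nat) : (m <= n)%N ->
  (\sum_(i < m) 'C(n - i.+1, t) + 'C(n - m, t.+1) = 'C(n, t.+1))%N.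
Proof.
elim: m => [|m IH] mn; first by rewrite big_ord0 subn0.
rewrite big_ord_recr /= -(IH (ltnW mn)) -addnA; congr addn.
by rewrite -(subnSK mn) binS addnC.
Qed.

(** * Averaging over user orders and cyclic shifts of the files *)

Section CyclicDemands.
Variables (n N' m : nat) (Q : finType).
Hypotheses (mn : (m <= n)%N) (mN : (m <= N'.+1)%N).
Variable c : 'I_N'.+1 * Q -> {set 'I_n}.

(** The number of files is a successor so that ['I_N'.+1] is a cyclic group; the sum is modulo the
    number of files. *)
Definition cyclic_file (z : 'I_N'.+1) (i : 'I_m) : 'I_N'.+1 := inord i + z.

Lemma cyclic_file_inj z : injective (cyclic_file z).
Proof.
move=> i j /addIr /(congr1 val) /=.
by rewrite !inordK ?(leq_trans (ltn_ord _))// => /val_inj.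
Qed.

(** Counterpart of [unknown_bits] when user [s i] stands at place [i] and demands [cyclic_file z i],
    and [c p] is the set of users caching [p]. *)
Definition cyclic_unknown (s : 'S_n) (z : 'I_N'.+1) : {set 'I_N'.+1 * Q} :=
  [set p | [exists i : 'I_m, (p.1 == cyclic_file z i) &&
     [disjoint s @: [set j : 'I_n | (j <= i)%N] & c p]]].

(** For fixed [p] and [s], each avoiding place [i] yields the shift [p.1 - i], under which place [i]
    demands the file of [p]; distinct places yield distinct shifts. *)
Lemma sum_avoiding_perms_le :
  (\sum_p \sum_(i < m) #|avoiding_perms [set j : 'I_n | (j <= i)%N] (c p)| <=
   \sum_(s : 'S_n) \sum_z #|cyclic_unknown s z|)%N.
Proof.
rewrite [leqRHS](_ : _ = \sum_p \sum_(s : 'S_n)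
    #|[set z | p \in cyclic_unknown s z]|)%N; last first.
  rewrite [RHS]exchange_big; apply: eq_bigr => s _ /=.
  under eq_bigr do rewrite -sum1_card big_mkcond /=.
  rewrite exchange_big; apply: eq_bigr => p _ /=.
  by rewrite -big_mkcond sum1dep_card.
apply: leq_sum => p _.
rewrite [leqLHS](_ : _ = \sum_(s : 'S_n)
    #|[set i : 'I_m |
        s \in avoiding_perms [set j : 'I_n | (j <= i)%N] (c p)]|)%N;
    last first.
  under eq_bigr do rewrite -sum1_card big_mkcond /=.
  rewrite exchange_big; apply: eq_bigr => s _ /=.
  by rewrite -big_mkcond sum1dep_card.
apply: leq_sum => s _.
have sub_inj : injective (fun i : 'I_m => p.1 - inord i : 'I_N'.+1).
  move=> i j /addrI /oppr_inj eqij; apply: (@cyclic_file_inj 0).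
  by rewrite /cyclic_file eqij.
rewrite -(card_imset _ sub_inj); apply/subset_leq_card/fintype.subsetP => z.
move=> /imsetP[i]; rewrite !inE => avoid ->; apply/existsP; exists i.
by rewrite avoid andbT /cyclic_file addrC subrK.
Qed.

(** A bit cached by t users is avoided by the first i + 1 places in n! C(n-i-1, t) / C(n, t) orders;
    [sum_bin_sub] sums this over i < m. *)
Lemma sum_bin_ratio_le (R : realType) (b : R) :
  (forall s z, #|cyclic_unknown s z|%:R <= b) ->
  \sum_p ('C(n, #|c p|.+1)%:R - 'C(n - m, #|c p|.+1)%:R) / 'C(n, #|c p|)%:R
    <= N'.+1%:R * b.
Proof.
move=> unk_le.
have fact0 : (0 < n`!%:R :> R) by rewrite ltr0n fact_gt0.
rewrite -(ler_pM2l fact0) mulr_sumr.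
have -> : n`!%:R * (N'.+1%:R * b) = \sum_(s : 'S_n) \sum_(z : 'I_N'.+1) b.
  by rewrite !sumr_const card_ord card_perms card_ord -(mulr_natl b) -[RHS]mulr_natl.
apply: le_trans (_ : \sum_(s : 'S_n) \sum_z #|cyclic_unknown s z|%:R <= _).
  have := sum_avoiding_perms_le; rewrite -(ler_nat R) natr_sum => le1.
  rewrite [leRHS](_ : _ = (\sum_(s : 'S_n) \sum_z #|cyclic_unknown s z|)%N%:R);
    last by rewrite natr_sum; apply: eq_bigr => s _; rewrite natr_sum.
  apply: le_trans le1; apply: ler_sum => p _.
  have cp : (#|c p| <= n)%N by rewrite -[leqRHS]card_ord max_card.
  have bin0 : (0 < 'C(n, #|c p|)%:R :> R) by rewrite ltr0n bin_gt0.
  rewrite mulrA ler_pdivrMr// -natrM -(sum_bin_sub _ mn) natrD addrK.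
  rewrite -natrM ler_nat.
  rewrite big_distrr big_distrl /=; apply: leq_sum => i _.
  have im : (i < n)%N by exact: leq_trans mn.
  have := card_avoiding_perms [set j : 'I_n | (j < i.+1)%N] (c p).
  by rewrite !card_ord card_ord_lt// [leqRHS]mulnC => ->.
by apply: ler_sum => s _; apply: ler_sum => z _.
Qed.

End CyclicDemands.

(** * Upper limits and convex envelopes *)

Lemma le_limn_esup (R : realType) (u : nat -> R) (e : \bar R) (L : R) :
  (limn_esup (fun n => (u n)%:E) <= L%:E)%E ->
  (forall eps, 0 < eps ->
    \forall n \near \oo%classic, (e <= (u n + eps)%:E)%E) ->
  (e <= L%:E)%E.
Proof.
move=> uL eu; apply/lee_addgt0Pr => eps eps0.
rewrite -leeBlDr//; apply: le_trans uL; apply: le_ereal_inf_tmp => _ [V Voo <-].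
have [n [Vn en]] := filter_ex (filterI Voo (eu _ eps0)).
apply: le_trans (_ : (u n)%:E <= _)%E; first by rewrite leeBlDr.
by apply: ereal_sup_ubound; exists n.
Qed.

Lemma lower_convex_envelope_le (R : realType) (n : nat) (p : 'I_n -> R * R)
    (w : 'I_n -> R) (i0 : 'I_n) (M : R) :
  (forall i, 0 <= w i) -> \sum_i w i = 1 ->
  \sum_i w i * (p i).1 <= M <= (p i0).1 -> (p i0).2 <= \sum_i w i * (p i).2 ->
  (lower_convex_envelope p M <= (\sum_i w i * (p i).2)%:E)%E.
Proof.
set M' := \sum_i w i * (p i).1; set y := \sum_i w i * (p i).2.
move=> w0 w1 /andP[M'M Mp] py.
(* The weight of [p i0] that moves the abscissa from [M'] to [M]. If the denominator is 0, then
   [M = M'] and division by zero gives the right weight 0. *)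
pose lam := (M - M') / ((p i0).1 - M').
have lam01 : 0 <= lam <= 1.
  rewrite /lam; have [->|ne] := eqVneq ((p i0).1 - M') 0.
    by rewrite invr0 mulr0 lexx ler01.
  have lt0 : 0 < (p i0).1 - M' by rewrite lt_neqAle eq_sym ne; lra.
  rewrite divr_ge0 ?ler_pdivrMr//; lra.
have lamE : M' + lam * ((p i0).1 - M') = M.
  rewrite /lam; have [eq0|ne] := eqVneq ((p i0).1 - M') 0.
    by rewrite eq0 mulr0; lra.
  by rewrite divfK//; lra.
pose w' i := (1 - lam) * w i + lam * (i == i0)%:R.
clearbody lam.
have w'E (f : 'I_n -> R) :
    \sum_i w' i * f i = (1 - lam) * \sum_i w i * f i + lam * f i0.
  under eq_bigr do rewrite mulrDl -!mulrA.
  rewrite big_split /= -!mulr_sumr; congr (_ + _ * _).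
  rewrite (bigD1 i0)//= eqxx mul1r big1 ?addr0// => i /negbTE ->.
  by rewrite mul0r.
apply: le_trans (_ : ((1 - lam) * y + lam * (p i0).2)%:E <= _)%E; last first.
  have /andP[l0 _] := lam01; rewrite lee_fin -subr_ge0.
  have -> : y - ((1 - lam) * y + lam * (p i0).2) = lam * (y - (p i0).2) by ring.
  by rewrite mulr_ge0// subr_ge0.
apply: ereal_inf_lbound; exists ((1 - lam) * y + lam * (p i0).2) => //.
exists w'; split.
- move=> i; have /andP[l0 l1] := lam01.
  by rewrite addr_ge0 ?mulr_ge0// subr_ge0.
- by have := w'E (fun=> 1); under eq_bigr do rewrite mulr1; move=> ->;
    under eq_bigr do rewrite mulr1; rewrite w1; ring.
- by rewrite w'E -/M' -[RHS]lamE; ring.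
- by rewrite w'E.
Qed.

(** * Relay loads and the users served by the first relays *)

Section MaxLinkLoad.
Variables (R : realType) (H r N B : nat) (S : scheme H r N B).

Lemma max_link_load_ge0 : 0 <= max_link_load R S.
Proof. exact: bigmax_ge_id. Qed.

Lemma relay_load_le_max (d : demand H r N) (h : 'I_H) :
  (1 <= r <= H)%N -> relay_load R S d h <= max_link_load R S.
Proof.
move=> /andP[r1 rH].
have H0 : (0 < H)%N by apply: leq_trans rH.
(* The maximum ranges over links, so [h] needs a user: swapping relay 0 with [h] in the set of the
   first [r] relays gives one. *)
pose K := tperm (Ordinal H0) h @: [set j : 'I_H | (j < r)%N].
have cK : #|K| == r by rewrite card_imset ?card_ord_lt//; exact: perm_inj.
have hK : h \in K by apply/imsetP; exists (Ordinal H0); rewrite ?inE ?tpermL.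
pose k : user H r := exist _ K cK.
rewrite /max_link_load (bigmaxD1 h)// le_max; apply/orP; left.
rewrite (bigmaxD1 k)// le_max; apply/orP; left.
by rewrite (bigmaxD1 d)// le_max le_max lexx.
Qed.

End MaxLinkLoad.

Lemma card_users_within (H r x : nat) : (x <= H)%N ->
  #|[set k : user H r | relays k \subset [set h : 'I_H | (h < x)%N]]|
  = 'C(x, r).
Proof.
move=> xH; set T := [set h | _].
rewrite -[in RHS](card_ord_lt xH) -cards_draws -(card_imset _ val_inj).
apply: eq_card => K; apply/imsetP/idP => [[k kT ->]|].
  by move: kT; rewrite !inE => ->; exact: (valP k).
rewrite inE => /andP[KT cK]; exists (exist _ K cK : user H r) => //.
by rewrite inE.
Qed.

(** * The bound for a single scheme *)

Section OneScheme.
Variables (R : realType) (H r N' B : nat) (S : scheme H r N'.+1 B).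
Variables (x n : nat) (e : 'I_n -> user H r).
Hypotheses (hr : (1 <= r <= H)%N) (xH : (x <= H)%N) (B0 : (0 < B)%N).
Hypotheses (e_inj : injective e)
  (eT : forall j, relays (e j) \subset [set h : 'I_H | (h < x)%N]).
Variable C : user H r -> {set 'I_N'.+1 * 'I_B}.
Hypotheses (HC : forall k, cached_bits S k (C k))
  (err : error_prob R S <= 2^-1).

Definition cachers (p : 'I_N'.+1 * 'I_B) : {set 'I_n} :=
  [set j | p \in C (e j)].

Lemma sum_bin_ratio_le_load :
  \sum_p ('C(n, #|cachers p|.+1)%:R - 'C(n - N'.+1, #|cachers p|.+1)%:R)
      / 'C(n, #|cachers p|)%:R
    <= N'.+1%:R * (x%:R * B%:R * max_link_load R S + 1).
Proof.
(* Only min(n, N) users can be ordered with distinct demands; truncated subtraction makes this the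
   max(n - N, 0) of the statement. *)
have nm : (n - N'.+1 = n - minn n N'.+1)%N by lia.
rewrite nm; apply: sum_bin_ratio_le; [exact: geq_minl|exact: geq_minr|].
move=> s z; set T := [set h : 'I_H | (h < x)%N].
pose v (i : 'I_(minn n N'.+1)) := e (s (widen_ord (geq_minl _ _) i)).
have v_inj : injective v.
  by move=> i j /e_inj /perm_inj /(congr1 val) /= /val_inj.
(* Users outside the order demand [z], an arbitrary choice. *)
pose d : demand H r N'.+1 :=
  [ffun k => if [pick i | v i == k] is Some i then cyclic_file z i else z].
have dv i : d (v i) = cyclic_file z i.
  rewrite ffunE; case: pickP => [j /eqP /v_inj ->//|/(_ i)].
  by rewrite eqxx.
apply: le_trans (_ : #|unknown_bits d C v|%:R <= _).
  rewrite ler_nat; apply/subset_leq_card/fintype.subsetP => p.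
  rewrite !inE => /existsP[i /andP[pi dis]]; apply/existsP; exists i.
  rewrite dv pi /=; apply/forallP => j; apply/implyP => ji.
  have sj : s (widen_ord (geq_minl _ _) j) \in s @: [set j : 'I_n | (j <= i)%N].
    by rewrite imset_f// inE.
  by have := disjointFr dis sj; rewrite inE => ->.
apply: le_trans (_ : (\sum_(h in T) relay_len S d h).+1%:R <= _).
  by rewrite ler_nat; apply: card_unknown_bits err => // i; exact: eT.
rewrite -addn1 natrD lerD2r natr_sum.
apply: le_trans (_ : \sum_(h in T) B%:R * max_link_load R S <= _).
  apply: ler_sum => h _; rewrite mulrC -ler_pdivrMr ?ltr0n//.
  exact: relay_load_le_max.
by rewrite sumr_const card_ord_lt// -[leLHS]mulr_natl mulrA.
Qed.

(** Double counting of the pairs of a user and a bit it caches. *)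
Lemma sum_cachers_le (M : R) : cache_within S M ->
  \sum_p #|cachers p|%:R <= n%:R * (M * B%:R).
Proof.
move=> wM.
rewrite [leLHS](_ : _ = \sum_(j < n) #|C (e j)|%:R).
  rewrite -[X in X%:R * _](card_ord n) mulr_natl -sumr_const.
  apply: ler_sum => j _; apply: le_trans (wM (e j)).
  by rewrite ler_nat (HC _).1.
rewrite -!natr_sum; congr _%:R.
under eq_bigr do rewrite -sum1_card big_mkcond.
rewrite exchange_big; apply: eq_bigr => j _ /=.
by rewrite -sum1_card [RHS]big_mkcond; apply: eq_bigr => p _; rewrite inE.
Qed.

End OneScheme.

Lemma envelope_le_load (R : realType) (H r N B x : nat) (S : scheme H r N B)
    (M : R) :
  (1 <= r <= H)%N -> (r <= x <= H)%N -> 0 <= M <= N%:R -> (0 < B)%N ->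
  uncoded S -> cache_within S M -> error_prob R S <= 2^-1 ->
  (lower_convex_envelope
     (fun t : 'I_('C(x, r)).+1 =>
        (t%:R * (N%:R / 'C(x, r)%:R),
         1 / x%:R *
         (('C('C(x, r), t.+1)%:R - 'C(maxn ('C(x, r) - N) 0, t.+1)%:R)
          / 'C('C(x, r), t)%:R))%R)
     M
   <= (max_link_load R S + B%:R^-1)%:E)%E.
Proof.
move=> hr /andP[rx xH] /andP[M0 MN] B0 uS wM err.
set n := 'C(x, r); set pt := fun t : 'I_n.+1 => _.
have n0 : (0 < n)%N by rewrite bin_gt0.
have x0 : (0 < x)%N by apply: leq_trans rx; case/andP: hr.
have nR : n%:R != 0 :> R by rewrite pnatr_eq0 -lt0n.
have pt0 t : 0 <= (pt t).2.
  rewrite /pt /= !(mulr_ge0, divr_ge0)// subr_ge0 ler_nat leq_bin2l//.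
  by rewrite maxn0 leq_subr.
have pt_max : pt ord_max = (N%:R, 0).
  rewrite /pt /= maxn0 (bin_small (ltnSn n)) (bin_small (_ : n - N < n.+1)%N);
    last by rewrite ltnS leq_subr.
  rewrite subrr mul0r mulr0.
  by congr (_, _); rewrite mulrCA mulfV// mulr1.
have L0 := max_link_load_ge0 R S.
(* Without files there are no shifts to average over, but the two binomials coincide and every
   ordinate is 0. *)
destruct N as [|N'].
  have pt2 t : (pt t).2 = 0 by rewrite /pt /= subn0 maxn0 subrr mul0r mulr0.
  apply: le_trans (_ : 0%:E <= _)%E; last by rewrite lee_fin addr_ge0 ?invr_ge0.
  have /le_trans : (lower_convex_envelope pt M
      <= (\sum_i (i == ord_max)%:R * (pt i).2)%:E)%E.
    have sumE (f : 'I_n.+1 -> R) : \sum_i (i == ord_max)%:R * f i = f ord_max.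
      rewrite (bigD1 ord_max)//= eqxx mul1r big1 ?addr0// => i /negbTE ->.
      by rewrite mul0r.
    apply: (@lower_convex_envelope_le _ _ _ _ ord_max) => //;
      rewrite ?sumE ?pt_max ?M0 ?MN//.
    by have := sumE (fun=> 1); under eq_bigr do rewrite mulr1.
  by apply; rewrite lee_fin big1// => i _; rewrite pt2 mulr0.
have [C HC] := uncoded_cached_bits uS.
pose A := [set k : user H r | relays k \subset [set h : 'I_H | (h < x)%N]].
have cA : n = #|A| by rewrite card_users_within.
pose e j : user H r := enum_val (cast_ord cA j).
have e_inj : injective e by move=> i j /enum_val_inj /cast_ord_inj.
have eA j : relays (e j) \subset [set h : 'I_H | (h < x)%N].
  by have := enum_valP (cast_ord cA j); rewrite inE.
have := sum_bin_ratio_le_load hr xH B0 e_inj eA HC err.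
have := sum_cachers_le e HC wM.
set c := cachers e C => memory load.
pose NB : R := N'.+1%:R * B%:R.
have NB0 : 0 < NB by rewrite mulr_gt0 ?ltr0n.
pose num p : 'I_n.+1 := inord #|c p|.
have numE p : num p = #|c p| :> nat.
  by rewrite inordK// ltnS -[leqRHS]card_ord max_card.
pose w (t : 'I_n.+1) : R := #|[pred p | num p == t]|%:R / NB.
have wE (f : 'I_n.+1 -> R) : \sum_t w t * f t = (\sum_p f (num p)) / NB.
  rewrite (partition_big num predT)//= mulr_suml; apply: eq_bigr => t _.
  rewrite (eq_bigr (fun=> f t)); last by move=> p /eqP ->.
  by rewrite sumr_const -[in RHS]mulr_natl /w mulrAC.
have w1 : \sum_t w t = 1.
  have := wE (fun=> 1); under eq_bigr do rewrite mulr1.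
  rewrite sumr_const card_prod !card_ord natrM => ->.
  by rewrite divff// gt_eqF.
have wM' : \sum_t w t * (pt t).1 <= M.
  rewrite wE ler_pdivrMr// -mulr_suml; under eq_bigr do rewrite numE.
  rewrite mulrA ler_pdivrMr ?ltr0n// /NB.
  have := ler_wpM2r (ler0n R N'.+1) memory; lra.
have le_load : \sum_t w t * (pt t).2 <= max_link_load R S + B%:R^-1.
  rewrite wE ler_pdivrMr// -mulr_sumr mul1r mulrC ler_pdivrMr ?ltr0n//.
  under eq_bigr do rewrite numE maxn0.
  apply: le_trans load _.
  (* The bit lost to decoding errors costs 1/(xB), which is at most the 1/B allowed. *)
  have x1 : 1 <= x%:R :> R by rewrite ler1n.
  rewrite /NB [leRHS](_ : _ =
    N'.+1%:R * (x%:R * B%:R * max_link_load R S + x%:R * (B%:R / B%:R)));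
    last by ring.
  by rewrite divff ?pnatr_eq0 -?lt0n// mulr1 ler_wpM2l// lerD2l.
apply: le_trans (_ : (\sum_t w t * (pt t).2)%:E <= _)%E; last first.
  by rewrite lee_fin.
apply: (@lower_convex_envelope_le _ _ _ _ ord_max) => //.
- by move=> t; rewrite divr_ge0// ltW.
- by rewrite wM' pt_max.
- by rewrite pt_max sumr_ge0// => t _; rewrite mulr_ge0// divr_ge0// ltW.
Qed.

Theorem theorem3 (R : realType) (H r N : nat)
    (hr : (1 <= r <= H)%N) (x : nat) (hx : (r <= x <= H)%N)
    (M : R) (hM : 0 <= M <= N%:R) :
  (lower_convex_envelope
     (fun t : 'I_('C(x, r)).+1 =>
        (t%:R * (N%:R / 'C(x, r)%:R),
         1 / x%:R *
         (('C('C(x, r), t.+1)%:R - 'C(maxn ('C(x, r) - N) 0, t.+1)%:R)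
          / 'C('C(x, r), t)%:R))%R)
     M
   <= opt_uncoded_load H r N M)%E.
Proof.
apply: le_ereal_inf_tmp => _ [L [B [S [Boo uw err0 supL]]] <-].
apply: le_limn_esup supL _ => eps eps0.
have half0 : (0 : R) < 2^-1 by rewrite invr_gt0.
(* Beyond this file size the correction 1/B is below [eps]. *)
have Blarge := Boo _ (nbhs_infty_gtr eps^-1).
near=> n; have [uS wM] := uw n.
have Bn : eps^-1 < (B n)%:R by near: n.
have B0 : 0 < (B n)%:R :> R by apply: lt_trans Bn; rewrite invr_gt0.
apply: (@le_trans _ _ (max_link_load R (S n) + (B n)%:R^-1)%:E).
  apply: envelope_le_load => //; first by rewrite -(ltr0n R).
  by near: n; exact: cvgr_le err0 _ half0.
by rewrite lee_fin lerD2l invf_ple ?posrE// ltW.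
Unshelve. all: by end_near. Qed.
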